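(* Let $N\ge 1$, let $a,b,c$ be constants, and let $\psi=\psi(n,m,l)$ be an $N$-component column vector function of $(n,m,l)\in\mathbb Z^3$ satisfying $$\overline{\psi}=\widetilde{\psi}+(c-a)\psi$$ together with its counterpart under the $n$-$m$-$l$ symmetry, $\overline{\psi}=\widehat{\psi}+(c-b)\psi$. Suppose there are invertible $N\times N$ matrices $A_{[l]}$, depending only on $l$ (not on $n,m$) and such that $A_{[l]}A_{[l+1]}^{-1}$ is independent of $l$, and an $N$-component auxiliary vector function $\sigma(n,m,l)$ such that $$\psi=A_{[l]}\,\sigma,\qquad \underline{\sigma}=-\widehat{\sigma}+(b+c)\sigma .$$ Then the Casoratian $$f=f(n,m,l)=\det\big(\psi(n,m,l),\psi(n,m,l+1),\dots,\psi(n,m,l+N-1)\big)$$ solves the bilinear system $$2c\, f\,\widetilde f+(a-c)\,\widetilde{\overline f}\;\underline f-(a+c)\,\overline f\;\underline{\widetilde f}=0,$$ $$2c\, f\,\widehat f+(b-c)\,\widehat{\overline f}\;\underline f-(b+c)\,\overline f\;\underline{\widehat f}=0,$$ and also the bilinear system $$(b+c)\,\widehat{\widetilde f}\;\overline f+(a-c)\,f\,\widehat{\widetilde{\overline f}}-(a+b)\,\widetilde f\,\widehat{\overline f}=0,$$ $$(c-b)\,\widehat{\widetilde f}\;\underline f-(a+c)\,f\,\underline{\widehat{\widetilde f}}+(a+b)\,\widetilde f\;\underline{\widehat f}=0,$$ $$(c-a)(b+c)\,\widetilde{\overline f}\;\underline{\widehat f}+(a+c)(b-c)\,\widehat{\overline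 f}\;\underline{\widetilde f}+2c(a-b)\,f\,\widehat{\widetilde f}=0,$$ at every $(n,m,l)$. Moreover, there automatically are auxiliary vectors $\omega(n,m,l)$, $\phi(n,m,l)$ and transform matrices $A_{[n]}$ (depending only on $n$) and $A_{[m]}$ (depending only on $m$), such that $\psi=A_{[n]}\,\omega$ and $\psi=A_{[m]}\,\phi$.
   Context: All functions are complex valued on the lattice $(n,m,l)\in\mathbb Z^3$; $a,b,c$ are complex constants associated with the directions $n,m,l$ respectively. Shift notation: for $u=u(n,m,l)$, $\widetilde u=u(n+1,m,l)$, $\widehat u=u(n,m+1,l)$, $\overline u=u(n,m,l+1)$, $\underline u=u(n,m,l-1)$; combined accents denote combined shifts, e.g. $\widehat{\widetilde{\overline f}}=f(n+1,m+1,l+1)$, $\underline{\widehat f}=f(n,m+1,l-1)$. The ''$n$-$m$-$l$ symmetric property'' means that the shift relation for $\psi$ is required to hold under permutation of the pairs $(n,a),(m,b),(l,c)$. A transform matrix $A_{[\mu]}$ ($\mu\in\{n,m,l\}$) is an invertible $N\times N$ matrix depending only on $\mu$, with $A_{[\mu]}A_{[\mu+1]}^{-1}$ independent of $\mu$. (These bilinear systems are the bilinear forms of the lattice equation H3: $p(u\widetilde u+\widehat u\,\widehat{\widetilde u})-q(u\widehat u+\widetilde u\,\widehat{\widetilde u})+\delta(p^2-q^2)=0$.) *)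

(* Defs.v *)
From HB Require Import structures.
From mathcomp Require Import all_boot all_order all_algebra.
From mathcomp Require Import reals.
From mathcomp Require Export complex.

Set Implicit Arguments.
Unset Strict Implicit.
Unset Printing Implicit Defensive.

Import GRing.Theory.
Local Open Scope ring_scope.

(* A family of constant matrices attached to one lattice direction; it depends
   on the coordinate [k] of that direction only. *)
Definition transform_matrix (R : realType) (N : nat)
    (A : int -> 'M[R[i]]_N) : Prop :=
  (forall k : int, A k \in unitmx) /\
  (forall j k : int,
     A j *m invmx (A (j + 1)) = A k *m invmx (A (k + 1))).

(* The columns are consecutive shifts in the third lattice direction. *)
Definition casoratian (R : realType) (N : nat)
    (psi : int -> int -> int -> 'cV[R[i]]_N) (n m l : int) : R[i] :=
  \det (\matrix_(i < N, j < N) psi n m (l + (j : nat)%:Z) i 0).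

(* Main.v *)
Require Import Defs.
From mathcomp Require Import all_boot all_order all_algebra.
From mathcomp Require Import perm.
From mathcomp Require Import boolp reals.
From mathcomp Require Import complex.
From mathcomp Require Import ring.

Set Implicit Arguments.
Unset Strict Implicit.
Unset Printing Implicit Defensive.

Import GRing.Theory.
Local Open Scope ring_scope.

(** Along a line in the [l] direction put [v j := psi n m (l + j)].  The shifts in
    [n], [m] and [l] become [v |-> (fun j => v (j + 1) - s v j)] with
    [s = c - a], [c - b] and [0].  The relation for [sigma] amounts to
    [psi(l+1) - 2c psi(l) + G psi(l-1) = 0] with [G = A_1 A_0^-1], so up to the
    factor [det (- G)] the backward shift in [l] is the one with [s = 2c].
    Bordering the matrix of [v 0, ..., v (N+1)] by two rows [(1, s, s^2, ...)]
    yields the Casoratian after the two shifts, times a difference of the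
    parameters, so the three-term Pluecker relation gives bilinear identities
    between shifted Casoratians for any parameters.  For the two equations
    without a factor [2c] one more parameter, [c + b], is used: it undoes the
    shift [c - b] up to the matrix [c^2 - b^2 - G]. *)

(** * Determinants with two free rows and the three-term Pluecker relation *)

Section BorderedDeterminant.

Variables (R : idomainType) (n : nat) (V : 'M[R]_(n, n.+2)).
Implicit Types p q r s : 'rV[R]_n.+2.

Definition bordered_mx p q : 'M[R]_n.+2 := col_mx p (col_mx q V).
Definition bordered_det p q : R := \det (bordered_mx p q).

Let i0 : 'I_n.+2 := 0.
Let i1 : 'I_n.+2 := lift 0 0.
Let i2 (i : 'I_n) : 'I_n.+2 := lift 0 (lift 0 i).

Let bordered_mx0 p q j : bordered_mx p q i0 j = p 0 j.
Proof.
rewrite -[RHS](col_mxEu p (col_mx q V) 0 j).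
by congr (col_mx _ _ _ _); apply: val_inj.
Qed.

Let bordered_mx1 p q j : bordered_mx p q i1 j = q 0 j.
Proof.
rewrite -[RHS](col_mxEu q V 0 j) -[RHS](col_mxEd p (col_mx q V) _ j).
by congr (col_mx _ _ _ _); apply: val_inj.
Qed.

Let bordered_mx2 p q i j : bordered_mx p q (i2 i) j = V i j.
Proof.
rewrite -[RHS](col_mxEd q V i j) -[RHS](col_mxEd p (col_mx q V) _ j).
by congr (col_mx _ _ _ _); apply: val_inj.
Qed.

Let i2P i : [\/ i = i0, i = i1 | exists i', i = i2 i'].
Proof.
case: (unliftP i0 i) => [k ->|->]; last by constructor 1.
case: (unliftP 0 k) => [i' ->|->]; last by constructor 2.
by constructor 3; exists i'.
Qed.

Let bordered_mxE := (bordered_mx0, bordered_mx1, bordered_mx2).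

Lemma bordered_det_alt p : bordered_det p p = 0.
Proof.
by apply: (@determinant_alternate _ _ _ i0 i1) => [|j]; rewrite ?bordered_mxE.
Qed.

(** The vector [k] collects the cofactors along the second row, which do not depend on [q]. Taking
    for [q] a row of [V] repeats a row, hence [V *m k = 0]. *)
Lemma bordered_det_linear p : exists k : 'cV[R]_n.+2,
  V *m k = 0 /\ forall q, bordered_det p q = (q *m k) 0 0.
Proof.
pose k := \col_j cofactor (bordered_mx p 0) i1 j.
have kE q : bordered_det p q = (q *m k) 0 0.
  rewrite /bordered_det (expand_det_row _ i1) [RHS]mxE; apply: eq_bigr => j _.
  rewrite bordered_mx1 [k _ _]mxE; congr (_ * _).
  rewrite /cofactor; congr (_ * \det _); apply/matrixP => i' j'.
  rewrite [LHS]mxE [RHS]mxE [LHS]mxE [RHS]mxE; have := neq_lift i1 i'.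
  by case: (i2P (lift i1 i')) => [->|->|[i ->]]; rewrite ?eqxx // !bordered_mxE.
exists k; split=> //; apply/matrixP => i j; rewrite ord1 [RHS]mxE.
rewrite -[LHS](_ : (row i V *m k) 0 0 = _); last by rewrite -row_mul mxE.
rewrite -kE; apply: (@determinant_alternate _ _ _ i1 (i2 i)) => // x.
by rewrite !bordered_mxE mxE.
Qed.

Lemma bordered_detC p q : bordered_det p q = - bordered_det q p.
Proof.
rewrite /bordered_det.
have -> : bordered_mx p q = xrow i0 i1 (bordered_mx q p).
  apply/matrixP => i j; rewrite [RHS]mxE.
  case: tpermP => [->|->|/eqP ni0 /eqP ni1]; rewrite ?bordered_mxE //.
  by case: (i2P i) ni0 ni1 => [->|->|[i' ->]]; rewrite ?eqxx // !bordered_mxE.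
by rewrite /xrow row_permE det_mulmx det_perm odd_tperm /= expr1 mulN1r.
Qed.

Let plucker_nz p q r s : bordered_det p q != 0 ->
  bordered_det p q * bordered_det r s - bordered_det p r * bordered_det q s
    + bordered_det p s * bordered_det q r = 0.
Proof.
move=> nz.
(* Cramer's rule in the rows of [bordered_mx p q]. *)
have [x [y [w es]]] : exists x y (w : 'rV_n),
    bordered_det p q *: s = x *: p + y *: q + w *m V.
  pose A : 'M_(1 + (1 + n)) := bordered_mx p q.
  pose z := s *m \adj A.
  exists (lsubmx z 0 0), (lsubmx (rsubmx z) 0 0), (rsubmx (rsubmx z)).
  have <- : z *m A = \det A *: s by rewrite -mulmxA mul_adj_mx mul_mx_scalar.
  rewrite -{1}(hsubmxK z) -{1}(hsubmxK (rsubmx z)) !mul_row_col addrA.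
  congr (_ + _ + _).
    by rewrite {1}[lsubmx z]mx11_scalar mul_scalar_mx.
  by rewrite {1}[lsubmx (rsubmx z)]mx11_scalar mul_scalar_mx.
(* Pairing Cramer's expansion of [s] with the cofactor vector of [t] kills the component
   [w *m V]. *)
have lin t : bordered_det p q * bordered_det t s
             = x * bordered_det t p + y * bordered_det t q.
  have [k [Vk kE]] := bordered_det_linear t.
  have : (bordered_det p q *: s) *m k = (x *: p + y *: q + w *m V) *m k.
    by rewrite es.
  rewrite !mulmxDl -mulmxA Vk mulmx0 addr0 -!scalemxAl => /matrixP/(_ 0 0).
  by rewrite !kE !mxE.
apply: (mulfI nz); rewrite mulr0 mulrDr mulrBr.
rewrite (mulrCA _ (bordered_det p r)) (mulrA _ (bordered_det p s)) !lin.
rewrite !bordered_det_alt (bordered_detC r p) (bordered_detC r q).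
rewrite (bordered_detC q p); ring.
Qed.

(** The relation is preserved, up to sign, by permuting the rows, so any nonzero determinant among
    [pq], [pr], [qr] can serve as the pivot. If all three vanish, so does every term. *)
Lemma bordered_det_plucker p q r s :
  bordered_det p q * bordered_det r s - bordered_det p r * bordered_det q s
    + bordered_det p s * bordered_det q r = 0.
Proof.
have [pq0|/(plucker_nz r s)//] := eqVneq (bordered_det p q) 0.
have [pr0|/(plucker_nz q s)] := eqVneq (bordered_det p r) 0; last first.
  rewrite (bordered_detC r q) => h; rewrite -[RHS]oppr0 -h; ring.
have [qr0|/(plucker_nz p s)] := eqVneq (bordered_det q r) 0.
  by rewrite pq0 pr0 qr0; ring.
rewrite (bordered_detC q p) (bordered_detC r p) pq0 pr0 => h.
rewrite -[RHS]h; ring.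
Qed.

End BorderedDeterminant.

(** * Casoratians of a sequence under parameter shifts *)

Definition seq_mx (R : nzRingType) (N k : nat) (v : nat -> 'cV[R]_N) :
  'M[R]_(N, k) := \matrix_(i, j) v j i 0.

Definition seq_det (R : comNzRingType) (N : nat) (v : nat -> 'cV[R]_N) : R :=
  \det (seq_mx N v).

Definition shift_sub (R : nzRingType) (N : nat) (s : R) (v : nat -> 'cV[R]_N) :
  nat -> 'cV[R]_N := fun j => v j.+1 - s *: v j.

Section SequenceDeterminants.

Variable R : idomainType.

Definition shift_mx k (s : R) : 'M[R]_(k.+1, k) :=
  \matrix_(i, j) ((i == lift 0 j)%:R - s *+ (i == widen_ord (leqnSn k) j)).

Definition power_row k (s : R) : 'rV[R]_k := \row_j s ^+ j.

(* The limit of [s ^- k *: power_row k.+1 s] as [s] tends to infinity. *)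
Definition last_row k : 'rV[R]_k.+1 := delta_mx 0 ord_max.

Lemma mul_shift_mxE m k s (X : 'M[R]_(m, k.+1)) i j :
  (X *m shift_mx k s) i j =
    X i (lift 0 j) - s * X i (widen_ord (leqnSn k) j).
Proof.
rewrite mxE; under eq_bigr do rewrite mxE mulrBr.
rewrite sumrB; congr (_ - _).
  rewrite (bigD1 (lift 0 j)) //= eqxx mulr1 big1 ?addr0 //.
  by move=> x /negPf->; rewrite mulr0.
rewrite (bigD1 (widen_ord (leqnSn k) j)) //= eqxx big1.
  by rewrite addr0 mulrC.
by move=> x /negPf->; rewrite mulr0.
Qed.

Lemma mul_power_row_shift k s t :
  power_row k.+1 t *m shift_mx k s = (t - s) *: power_row k t.
Proof.
by apply/rowP=> j; rewrite mul_shift_mxE !mxE lift0 exprS mulrBl.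
Qed.

Lemma mul_last_row_shift k s : last_row k.+1 *m shift_mx k.+1 s = last_row k.
Proof.
apply/rowP=> j; rewrite mul_shift_mxE !mxE !eqxx /= -!val_eqE /= eqSS.
by rewrite (ltn_eqF (ltn_ord j)) mulr0 subr0.
Qed.

Lemma mul_seq_mx_shift N k s (v : nat -> 'cV[R]_N) :
  seq_mx k.+1 v *m shift_mx k s = seq_mx k (shift_sub s v).
Proof. by apply/matrixP=> i j; rewrite mul_shift_mxE !mxE lift0. Qed.

(** Column operations: prefixing [shift_mx n s] with the first unit column gives a unitriangular
    [U], and right multiplication by [U] turns the power row into [(1, 0, ..., 0)]. *)
Lemma det_power_row n s (W : 'M[R]_(n, n.+1)) :
  \det (col_mx (power_row n.+1 s) W : 'M_n.+1) = \det (W *m shift_mx n s).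
Proof.
pose U : 'M_(1 + n) := row_mx (delta_mx 0 0) (shift_mx n s).
have detU : \det U = 1.
  rewrite -det_tr det_trig.
    rewrite big1 // => i _; rewrite mxE.
    case: (split_ordP i) => j ->; rewrite ?row_mxEl ?row_mxEr mxE.
      by rewrite ord1.
    by rewrite -!val_eqE /= eqxx add1n gtn_eqF ?leqnn // subr0.
  apply/is_trig_mxP => i j lt_ij; rewrite mxE.
  case: (split_ordP i) lt_ij => k ->; rewrite ?row_mxEl ?row_mxEr mxE -!val_eqE.
    by rewrite /= !ord1 /= => /gtn_eqF->.
  by rewrite /= add1n => ltk; rewrite !gtn_eqF ?subrr // ltnW.
have := mul_col_row (power_row n.+1 s) W (delta_mx 0 0 : 'cV_n.+1) (shift_mx n s).
rewrite mul_power_row_shift subrr scale0r => eAU.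
rewrite -[LHS]mulr1 -detU -det_mulmx.
rewrite (etrans (congr1 (@determinant R (1 + n)) eAU) (det_lblock _ _ _)).
rewrite det_mx11 mxE (bigD1 0) //= !mxE expr0 mulr1 big1 ?addr0 ?mul1r //.
by move=> i /negPf ni; rewrite !mxE ni mulr0.
Qed.

Lemma det_last_row N (v : nat -> 'cV[R]_N) :
  \det (col_mx (last_row N) (seq_mx N.+1 v) : 'M_N.+1) = (-1) ^+ N * seq_det v.
Proof.
have e0 : (0 : 'I_N.+1) = lshift N (0 : 'I_1) by apply: val_inj.
have eS i : lift 0 i = rshift 1 i :> 'I_N.+1 by apply: val_inj.
rewrite (expand_det_row _ 0) (bigD1 ord_max) //= big1 => [|j /negPf nj]; last first.
  by rewrite e0 (col_mxEu (last_row N)) mxE nj mul0r.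
rewrite addr0 {1}e0 (col_mxEu (last_row N)) [X in X * _]mxE !eqxx mul1r.
rewrite /cofactor add0n; congr (_ * \det _); apply/matrixP => i j.
rewrite [LHS]mxE [LHS]mxE eS (col_mxEd (last_row N)) !mxE.
by rewrite lift_max.
Qed.

Lemma det_scale_first_row n a (q : 'rV[R]_(1 + n)) (W : 'M[R]_(n, 1 + n)) :
  \det (col_mx (a *: q) W) = a * \det (col_mx q W).
Proof.
have -> : col_mx (a *: q) W = block_mx a%:M 0 0 1%:M *m col_mx q W.
  by rewrite mul_block_col !mul0mx mul1mx mul_scalar_mx addr0 add0r.
by rewrite det_mulmx det_ublock det_scalar1 det1 mulr1.
Qed.

Lemma bordered_det_power_row n (V : 'M[R]_(n, n.+2)) s q :
  bordered_det V (power_row _ s) q =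
    \det (col_mx (q *m shift_mx _ s) (V *m shift_mx _ s) : 'M_n.+1).
Proof.
apply: etrans (det_power_row s (col_mx q V)) _.
by congr (\det _); apply: (mul_col_mx q V).
Qed.

Variables (N : nat) (v : nat -> 'cV[R]_N).

Local Notation tau1 s := (seq_det (shift_sub s v)).
Local Notation tau2 s t := (seq_det (shift_sub s (shift_sub t v))).

Lemma bordered_det_powers s t :
  bordered_det (seq_mx N.+2 v) (power_row _ s) (power_row _ t)
    = (t - s) * tau2 t s.
Proof.
rewrite bordered_det_power_row mul_power_row_shift mul_seq_mx_shift.
rewrite (det_scale_first_row (t - s) (power_row _ t)) det_power_row.
by rewrite mul_seq_mx_shift.
Qed.

Lemma bordered_det_power_last s :
  bordered_det (seq_mx N.+2 v) (power_row _ s) (last_row _)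
    = (-1) ^+ N * tau1 s.
Proof.
by rewrite bordered_det_power_row mul_last_row_shift mul_seq_mx_shift det_last_row.
Qed.

(** The Pluecker relation with [last_row] as fourth row, that is, with one parameter sent to
    infinity. Every term then carries the same sign [(-1) ^+ N], which cancels. *)
Lemma hirota_miwa3 p q r :
  (q - p) * tau2 q p * tau1 r - (r - p) * tau2 r p * tau1 q
    + (r - q) * tau2 r q * tau1 p = 0.
Proof.
have := bordered_det_plucker (seq_mx N.+2 v) (power_row _ p) (power_row _ q)
  (power_row _ r) (last_row _).
rewrite !bordered_det_powers !bordered_det_power_last.
have : (-1) ^+ N != 0 :> R by rewrite signr_eq0.
do !move: (seq_det _) => ?; move: ((-1) ^+ N) => e nz h.
by apply: (mulfI nz); rewrite mulr0 -[RHS]h; ring.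
Qed.

Lemma hirota_miwa4 p q r s :
  (q - p) * (s - r) * tau2 q p * tau2 s r
    - (r - p) * (s - q) * tau2 r p * tau2 s q
    + (s - p) * (r - q) * tau2 s p * tau2 r q = 0.
Proof.
have := bordered_det_plucker (seq_mx N.+2 v) (power_row _ p) (power_row _ q)
  (power_row _ r) (power_row _ s).
rewrite !bordered_det_powers; do !move: (seq_det _) => ?.
by move=> h; rewrite -[RHS]h; ring.
Qed.

End SequenceDeterminants.


Lemma seq_det_mul (R : comNzRingType) N (A : 'M[R]_N) v :
  seq_det (fun j => A *m v j) = \det A * seq_det v.
Proof.
rewrite -det_mulmx; congr (\det _); apply/matrixP => i j; rewrite !mxE.
by apply: eq_bigr => k _; rewrite mxE.
Qed.

Lemma shift_subC (R : comNzRingType) N (s t : R) (v : nat -> 'cV[R]_N) :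
  shift_sub s (shift_sub t v) = shift_sub t (shift_sub s v).
Proof. by apply: funext => j; apply/matrixP => i k; rewrite !mxE; ring. Qed.

Lemma shift_sub_mul (R : comNzRingType) N (s : R) (A : 'M[R]_N) v :
  shift_sub s (fun j => A *m v j) = (fun j => A *m shift_sub s v j).
Proof. by apply: funext => j; rewrite /shift_sub mulmxBr scalemxAr. Qed.

(** * Identities with a reflected parameter, by specialization *)

Section Morphism.

Variables (R S : comNzRingType) (phi : {rmorphism R -> S}) (N : nat).

Lemma rmorph_seq_det (v : nat -> 'cV[R]_N) :
  phi (seq_det v) = seq_det (fun j => map_mx phi (v j)).
Proof.
by rewrite -det_map_mx; congr (\det _); apply/matrixP => i j; rewrite !mxE.
Qed.

Lemma map_shift_sub s (v : nat -> 'cV[R]_N) :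
  (fun j => map_mx phi (shift_sub s v j))
    = shift_sub (phi s) (fun j => map_mx phi (v j)).
Proof. by apply: funext => j; rewrite /shift_sub map_mxB map_mxZ. Qed.

End Morphism.

Definition reflected_tau (R : comNzRingType) N (v : nat -> 'cV[R]_N)
    (x y z w : R) : R :=
  (w - z) * seq_det (shift_sub x (shift_sub y v)) * seq_det (shift_sub z v)
  + (z - x) * seq_det v * seq_det (shift_sub x (shift_sub z (shift_sub y v)))
  + (x - w) * seq_det (shift_sub x v) * seq_det (shift_sub z (shift_sub y v)).

Lemma rmorph_reflected_tau (R S : comNzRingType) (phi : {rmorphism R -> S}) N
    (v : nat -> 'cV[R]_N) x y z w :
  phi (reflected_tau v x y z w) =
  reflected_tau (fun j => map_mx phi (v j)) (phi x) (phi y) (phi z) (phi w).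
Proof.
by rewrite /reflected_tau !rmorphD !rmorphM !rmorphB !rmorph_seq_det
   !map_shift_sub.
Qed.

(** In [hirota_miwa3] for [shift_sub y v] with parameters [z], [x], [w], each term has exactly one
    factor shifted by [w]. There [w] and [y] cancel at the price of [\det K]. *)
Lemma reflected_tau_unit (R : idomainType) N (v : nat -> 'cV[R]_N)
    (K : 'M[R]_N) (x y z w : R) :
  shift_sub w (shift_sub y v) = (fun j => K *m v j) -> \det K != 0 ->
  reflected_tau v x y z w = 0.
Proof.
move=> vK nzK; apply: (mulfI nzK); rewrite mulr0 /reflected_tau.
have redK t : seq_det (shift_sub w (shift_sub t (shift_sub y v)))
              = \det K * seq_det (shift_sub t v).
  by rewrite -seq_det_mul shift_subC vK shift_sub_mul.
have := hirota_miwa3 (shift_sub y v) z x w.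
rewrite vK seq_det_mul !redK (shift_subC x z).
do !move: (seq_det _) => ?; move: (\det K) => d h.
by rewrite -[RHS]oppr0 -[X in _ = - X]h; ring.
Qed.

(** Up to sign this is the characteristic polynomial of [M] composed with ['X ^+ 2]; composing a
    nonzero polynomial with a nonconstant one never gives zero. *)
Lemma det_quadratic_neq0 (F : fieldType) N (M : 'M[F]_N) :
  \det (map_mx polyC M - ('X ^+ 2)%:M) != 0.
Proof.
have -> : map_mx polyC M - ('X ^+ 2)%:M
        = -1 *: map_mx (comp_poly ('X ^+ 2)) (char_poly_mx M).
  apply/matrixP => i j; rewrite !mxE.
  by rewrite rmorphB rmorphMn /= comp_polyX comp_polyC mulN1r opprB.
rewrite detZ mulf_neq0 ?signr_eq0 // det_map_mx.
by rewrite comp_poly_eq0 ?size_polyXn // -size_poly_eq0 size_char_poly.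
Qed.

Lemma reflected_tau_eq0 (F : fieldType) N (v : nat -> 'cV[F]_N) (G : 'M[F]_N)
    (b c x z : F) :
  (forall j, v j.+2 = (2 * c) *: v j.+1 - G *m v j) ->
  reflected_tau v x (c - b) z (c + b) = 0.
Proof.
(* [c^2 - b^2 - G] may be singular: treat [b] as an indeterminate, for which its
   determinant is nonzero, and specialize. *)
move=> recv; pose vX j := map_mx polyC (v j).
pose phi : {rmorphism {poly F} -> F} := horner_eval b.
have phiC y : phi y%:P = y by rewrite /phi /= horner_evalE hornerC.
have phiX : phi 'X = b by rewrite /phi /= horner_evalE hornerX.
have -> : v = fun j => map_mx phi (vX j).
  by apply: funext => j; apply/matrixP => k l; rewrite !mxE phiC.
have -> : c - b = phi (c%:P - 'X) by rewrite rmorphB phiC phiX.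
have -> : c + b = phi (c%:P + 'X) by rewrite rmorphD phiC phiX.
rewrite -{1}(phiC x) -{1}(phiC z) -rmorph_reflected_tau.
pose K := map_mx polyC ((c ^+ 2)%:M - G) - ('X ^+ 2)%:M.
rewrite (@reflected_tau_unit _ _ _ K) ?rmorph0 ?det_quadratic_neq0 //.
(* With [E] the index shift, [(E - (c + X)) (E - (c - X)) = E^2 - 2 c E + c^2 - X^2], and the
   recurrence replaces [E^2 - 2 c E] by [- G]. *)
apply: funext => j; rewrite /shift_sub /vX recv.
apply/matrixP => k l.
rewrite /K mulmxBl mul_scalar_mx !map_mxB mulmxBl map_scalar_mx mul_scalar_mx.
rewrite -map_mxM !mxE !(rmorphB, rmorphM, rmorphXn) /=.
ring.
Qed.

(** * The five bilinear equations *)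

Section Lattice.

Variables (F : fieldType) (N : nat) (a b c : F) (G : 'M[F]_N).
Variable psi : int -> int -> int -> 'cV[F]_N.
Hypothesis psi_n : forall n m l,
  psi n m (l + 1) = psi (n + 1) m l + (c - a) *: psi n m l.
Hypothesis psi_m : forall n m l,
  psi n m (l + 1) = psi n (m + 1) l + (c - b) *: psi n m l.
Hypothesis psi_l : forall n m l,
  psi n m (l + 1) = (2 * c) *: psi n m l - G *m psi n m (l - 1).
Hypothesis G_unit : G \in unitmx.

Let line n m l (j : nat) : 'cV[F]_N := psi n m (l + j%:Z).
Let f n m l : F := seq_det (line n m l).
Let g : F := \det (- G).

Let lineS n m l j : line n m l j.+1 = psi n m (l + j%:Z + 1).
Proof. by rewrite /line -addrA -PoszD addn1. Qed.

Let line_n n m l : shift_sub (c - a) (line n m l) = line (n + 1) m l.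
Proof. by apply: funext => j; rewrite /shift_sub lineS psi_n addrK. Qed.

Let line_m n m l : shift_sub (c - b) (line n m l) = line n (m + 1) l.
Proof. by apply: funext => j; rewrite /shift_sub lineS psi_m addrK. Qed.

Let line_l n m l : shift_sub 0 (line n m l) = line n m (l + 1).
Proof.
by apply: funext => j; rewrite /shift_sub scale0r subr0 lineS /line addrAC.
Qed.

Let line_rec n m l j :
  line n m l j.+2 = (2 * c) *: line n m l j.+1 - G *m line n m l j.
Proof.
by rewrite !lineS intS (addrC 1) addrA psi_l addrK.
Qed.

Let seq_det_line_pred n m l :
  seq_det (shift_sub (2 * c) (line n m l)) = g * f n m (l - 1).
Proof.
rewrite /f /g -seq_det_mul; congr seq_det; apply: funext => j.
rewrite /shift_sub lineS psi_l addrAC subrr add0r mulNmx.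
by rewrite /line addrAC.
Qed.

Let g_neq0 : g != 0.
Proof.
rewrite /g -scaleN1r detZ mulf_neq0 ?signr_eq0 // -unitfE.
by move: G_unit; rewrite unitmxE.
Qed.

Lemma bilinear_n n m l :
  2 * c * f n m l * f (n + 1) m l
    + (a - c) * f (n + 1) m (l + 1) * f n m (l - 1)
    - (a + c) * f n m (l + 1) * f (n + 1) m (l - 1) = 0.
Proof.
(* The parameters stand for the forward [l], the [n] and the backward [l] shift. Each term contains
   [2 * c] once, hence one factor [g]. *)
have := hirota_miwa3 (line n m l) 0 (c - a) (2 * c).
rewrite line_l !line_n !seq_det_line_pred addrK -!/(f _ _ _) => h.
apply: (mulfI g_neq0); rewrite mulr0 -[RHS]oppr0 -[X in _ = - X]h; ring.
Qed.

Lemma bilinear_m n m l :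
  2 * c * f n m l * f n (m + 1) l
    + (b - c) * f n (m + 1) (l + 1) * f n m (l - 1)
    - (b + c) * f n m (l + 1) * f n (m + 1) (l - 1) = 0.
Proof.
have := hirota_miwa3 (line n m l) 0 (c - b) (2 * c).
rewrite line_l !line_m !seq_det_line_pred addrK -!/(f _ _ _) => h.
apply: (mulfI g_neq0); rewrite mulr0 -[RHS]oppr0 -[X in _ = - X]h; ring.
Qed.

Lemma bilinear_succ n m l :
  (b + c) * f (n + 1) (m + 1) l * f n m (l + 1)
    + (a - c) * f n m l * f (n + 1) (m + 1) (l + 1)
    - (a + b) * f (n + 1) m l * f n (m + 1) (l + 1) = 0.
Proof.
(* Here [z = 0] is the forward [l] shift; the coefficients [w - z], [z - x], [x - w] become [c + b],
   [a - c], [- (a + b)]. *)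
have := reflected_tau_eq0 b (c - a) 0 (line_rec n m l).
rewrite /reflected_tau line_m !line_l !line_n -!/(f _ _ _) => h.
rewrite -[RHS]h; ring.
Qed.

Lemma bilinear_pred n m l :
  (c - b) * f (n + 1) (m + 1) l * f n m (l - 1)
    - (a + c) * f n m l * f (n + 1) (m + 1) (l - 1)
    + (a + b) * f (n + 1) m l * f n (m + 1) (l - 1) = 0.
Proof.
have := reflected_tau_eq0 b (c - a) (2 * c) (line_rec n m l).
rewrite /reflected_tau (shift_subC (c - a) (2 * c)) line_m !line_n.
rewrite !seq_det_line_pred -!/(f _ _ _) => h.
apply: (mulfI g_neq0); rewrite mulr0 -[RHS]oppr0 -[X in _ = - X]h; ring.
Qed.

Lemma bilinear_mixed n m l :
  (c - a) * (b + c) * f (n + 1) m (l + 1) * f n (m + 1) (l - 1)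
    + (a + c) * (b - c) * f n (m + 1) (l + 1) * f (n + 1) m (l - 1)
    + 2 * c * (a - b) * f n m l * f (n + 1) (m + 1) l = 0.
Proof.
(* All four lattice shifts enter, paired in the three possible ways. *)
have := hirota_miwa4 (line n m l) 0 (c - a) (c - b) (2 * c).
rewrite line_l (shift_subC (c - b) (c - a)) !line_m !line_n.
rewrite !seq_det_line_pred addrK -!/(f _ _ _) => h.
apply: (mulfI g_neq0); rewrite mulr0 -[RHS]h; ring.
Qed.

End Lattice.

(** * Transform matrices and auxiliary vectors for the other two directions *)

Lemma exists_transform_matrix (R : realType) N (K : 'M[R[i]]_N) :
  exists A : int -> 'M[R[i]]_N, transform_matrix A /\
    (K \in unitmx -> forall k, invmx (A (k - 1)) = invmx (A k) *m K).
Proof.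
(* For singular [K] the second clause is vacuous and the constant identity family serves. *)
have [Ku|nKu] := boolP (K \in unitmx); last first.
  exists (fun=> 1%:M); split=> //; split=> // k; exact: unitmx1.
case: N K Ku => [|N] K Ku.
  exists (fun=> 1%:M); split=> [|_ k]; last by rewrite !thinmx0.
  split=> // k; exact: unitmx1.
(* The inverse of [K ^ k] is [K ^ (- k)], so lowering [k] by one multiplies it by [K]. *)
exists (fun k => K ^ k); split.
  split=> [k|j k]; first exact: unitrXz.
  have cst i : K ^ i *m invmx (K ^ (i + 1)) = invmx K.
    by rewrite mulmxE -[invmx _]/((K ^ (i + 1))^-1) invr_expz -exprzDr //
      opprD addNKr exprN1.
  by rewrite !cst.
move=> _ k; rewrite -[invmx _]/((K ^ (k - 1))^-1) -[invmx _]/((K ^ k)^-1).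
by rewrite !invr_expz opprB addrC exprzDr // expr1z.
Qed.

(** Substituting [E = T + c - a] in [E^2 - 2 c E + G = 0] gives [T^2 - 2 a T + (a^2 - c^2 + G) = 0]:
    the shift [T] in [n] obeys a relation of the same form, with [a] for [c] and a new constant
    matrix for [G]. *)
Lemma shift_quadratic (F : fieldType) N (a c : F) (G : 'M[F]_N) v0 v1 v2 :
  v2 = (2 * c) *: v1 - G *m v0 ->
  ((a ^+ 2 - c ^+ 2)%:M + G) *m v0
    = (2 * a) *: (v1 - (c - a) *: v0)
      - (v2 - (c - a) *: v1 - (c - a) *: (v1 - (c - a) *: v0)) :> 'cV_N.
Proof.
move=> ->; rewrite mulmxDl mul_scalar_mx; move: (G *m v0) => w.
by apply/matrixP => i j; rewrite !mxE; ring.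
Qed.

Theorem theorem1 (R : realType) (N : nat) (hN : (1 <= N)%N) (a b c : R[i])
    (psi : int -> int -> int -> 'cV[R[i]]_N)
    (hpsi_n : forall n m l : int,
       psi n m (l + 1) = psi (n + 1) m l + (c - a) *: psi n m l)
    (hpsi_m : forall n m l : int,
       psi n m (l + 1) = psi n (m + 1) l + (c - b) *: psi n m l)
    (A_l : int -> 'M[R[i]]_N) (hA_l : transform_matrix A_l)
    (sigma : int -> int -> int -> 'cV[R[i]]_N)
    (hpsi_sigma : forall n m l : int, psi n m l = A_l l *m sigma n m l)
    (hsigma : forall n m l : int,
       sigma n m (l - 1) = - sigma n (m + 1) l + (b + c) *: sigma n m l) :
  let f := casoratian psi in
  (forall n m l : int,
     2 * c * f n m l * f (n + 1) m l
       + (a - c) * f (n + 1) m (l + 1) * f n m (l - 1)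
       - (a + c) * f n m (l + 1) * f (n + 1) m (l - 1) = 0
     /\
     2 * c * f n m l * f n (m + 1) l
       + (b - c) * f n (m + 1) (l + 1) * f n m (l - 1)
       - (b + c) * f n m (l + 1) * f n (m + 1) (l - 1) = 0)
  /\
  (forall n m l : int,
     [/\ (b + c) * f (n + 1) (m + 1) l * f n m (l + 1)
           + (a - c) * f n m l * f (n + 1) (m + 1) (l + 1)
           - (a + b) * f (n + 1) m l * f n (m + 1) (l + 1) = 0,
         (c - b) * f (n + 1) (m + 1) l * f n m (l - 1)
           - (a + c) * f n m l * f (n + 1) (m + 1) (l - 1)
           + (a + b) * f (n + 1) m l * f n (m + 1) (l - 1) = 0
       & (c - a) * (b + c) * f (n + 1) m (l + 1) * f n (m + 1) (l - 1)
           + (a + c) * (b - c) * f n (m + 1) (l + 1) * f (n + 1) m (l - 1)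
           + 2 * c * (a - b) * f n m l * f (n + 1) (m + 1) l = 0])
  /\
  (* The existence of the auxiliary vectors and transform matrices is
     unconditional.  Their shift relations, the symmetric counterparts of
     [hsigma], are only possible in general when the matrices below (diagonal
     entries [a ^+ 2 - k_j ^+ 2] and [b ^+ 2 - k_j ^+ 2] for the plane-wave
     solutions with spectral parameters [k_j]) are invertible. *)
  (exists (omega phi : int -> int -> int -> 'cV[R[i]]_N)
          (A_n A_m : int -> 'M[R[i]]_N),
     [/\ transform_matrix A_n,
         transform_matrix A_m,
         (forall n m l : int, psi n m l = A_n n *m omega n m l)
           /\ (forall n m l : int, psi n m l = A_m m *m phi n m l),
         ((a ^+ 2 - c ^+ 2)%:M + A_l 1 *m invmx (A_l 0) \in unitmx ->
          forall n m l : int,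
            omega (n - 1) m l
              = - omega n (m + 1) l + (a + b) *: omega n m l
            /\
            omega (n - 1) m l
              = - omega n m (l + 1) + (a + c) *: omega n m l)
       & ((b ^+ 2 - c ^+ 2)%:M + A_l 1 *m invmx (A_l 0) \in unitmx ->
          forall n m l : int,
            phi n (m - 1) l
              = - phi (n + 1) m l + (a + b) *: phi n m l
            /\
            phi n (m - 1) l
              = - phi n m (l + 1) + (b + c) *: phi n m l)]).
Proof.
have [A_u A_cst] := hA_l.
pose G := A_l 1 *m invmx (A_l 0).
have G_unit : G \in unitmx by rewrite unitmx_mul unitmx_inv !A_u.
(* Constancy of the quotient identifies [A_l (k - 1) *m invmx (A_l k)] with the inverse of [G] for
   every [k]. *)
have G_step k : G *m (A_l (k - 1) *m invmx (A_l k)) = 1%:M.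
  have := A_cst (k - 1) 0; rewrite subrK add0r => ->.
  by rewrite mulmxA mulmxKV ?A_u // mulmxV ?A_u.
(* In terms of [psi], [hsigma] reads [G psi(l-1) = - psi(m+1) + (b + c) psi]; adding [hpsi_m]
   eliminates [psi(m+1)], and [(c - b) + (b + c) = 2 c]. *)
have psi_l n m l :
    psi n m (l + 1) = (2 * c) *: psi n m l - G *m psi n m (l - 1).
  have sg k : sigma n k l = invmx (A_l l) *m psi n k l.
    by rewrite hpsi_sigma mulKmx ?A_u.
  have -> : psi n m (l - 1) = A_l (l - 1) *m invmx (A_l l) *m
                              (- psi n (m + 1) l + (b + c) *: psi n m l).
    rewrite hpsi_sigma hsigma !sg -mulmxA; congr (_ *m _).
    by rewrite mulmxDr mulmxN scalemxAr.
  rewrite mulmxA G_step mul1mx.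
  by rewrite hpsi_m; apply/matrixP => i j; rewrite !mxE; ring.
split=> [n m l|].
  by split; [exact: (bilinear_n hpsi_n psi_l G_unit)
            |exact: (bilinear_m hpsi_m psi_l G_unit)].
split=> [n m l|].
  split; [exact: (bilinear_succ hpsi_n hpsi_m psi_l)
         |exact: (bilinear_pred hpsi_n hpsi_m psi_l G_unit)
         |exact: (bilinear_mixed hpsi_n hpsi_m psi_l G_unit)].
(* The step matrix is the constant term of the quadratic relation for the [n] shift, so that it maps
   [psi(n-1)] to [2 a psi - psi(n+1)]. *)
have [A_n [A_nT A_n_pred]] := exists_transform_matrix ((a ^+ 2 - c ^+ 2)%:M + G).
have [A_m [A_mT A_m_pred]] := exists_transform_matrix ((b ^+ 2 - c ^+ 2)%:M + G).
exists (fun n m l => invmx (A_n n) *m psi n m l).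
exists (fun n m l => invmx (A_m m) *m psi n m l).
exists A_n, A_m; split=> //.
- by split=> n m l; rewrite mulKVmx //; [case: A_nT|case: A_mT].
- move=> Ku n m l; rewrite (A_n_pred Ku) -mulmxA.
  have e : psi (n - 1) m (l + 1 + 1) = (2 * c) *: psi (n - 1) m (l + 1)
           - G *m psi (n - 1) m l by rewrite psi_l addrK.
  rewrite (shift_quadratic a e).
  have e1 k : psi (n - 1) m (k + 1) - (c - a) *: psi (n - 1) m k = psi n m k.
    by rewrite hpsi_n addrK subrK.
  rewrite !e1 -!mulmxN !scalemxAr -!mulmxDr.
  (* It remains to write [psi(n+1)] as [psi(m+1) + (a - b) psi] for the first relation and as
     [psi(l+1) - (c - a) psi] for the second. *)
  split; congr (_ *m _); rewrite ?hpsi_n.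
    have := hpsi_m n m l; rewrite hpsi_n => /(canRL (addrK _)) ->.
    by apply/matrixP => i j; rewrite !mxE; ring.
  by apply/matrixP => i j; rewrite !mxE; ring.
- move=> Ku n m l; rewrite (A_m_pred Ku) -mulmxA.
  have e : psi n (m - 1) (l + 1 + 1) = (2 * c) *: psi n (m - 1) (l + 1)
           - G *m psi n (m - 1) l by rewrite psi_l addrK.
  rewrite (shift_quadratic b e).
  have e1 k : psi n (m - 1) (k + 1) - (c - b) *: psi n (m - 1) k = psi n m k.
    by rewrite hpsi_m addrK subrK.
  rewrite !e1 -!mulmxN !scalemxAr -!mulmxDr.
  split; congr (_ *m _); rewrite ?hpsi_m.
    have := hpsi_n n m l; rewrite hpsi_m => /(canRL (addrK _)) ->.
    by apply/matrixP => i j; rewrite !mxE; ring.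
  by apply/matrixP => i j; rewrite !mxE; ring.
Qed.
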